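(* There is no chiral polytope whose facets are (all isomorphic to) a finite, flat, regular polytope $\mathcal{K}$ and whose vertex-figures are (all isomorphic to) a finite regular polytope $\mathcal{L}$.
   Context: An (abstract) $n$-polytope is a partially ordered set $\mathcal{P}$ with a unique minimal face $F_{-1}$ and a unique maximal face $F_n$, in which all maximal chains (called flags) have the same length, so that there is a rank function with $\operatorname{rank} F_{-1}=-1$ and $\operatorname{rank} F_n = n$, and which satisfies: (diamond condition) whenever $F<G$ and $\operatorname{rank}G-\operatorname{rank}F=2$ there are exactly two faces $H$ with $F<H<G$; (strong connectivity) whenever $F<G$ with $\operatorname{rank}G-\operatorname{rank}F\ge 3$ and $F<H<G$, $F<H'<G$, there is a chain $H=H_0\le H_1\ge H_2\le \cdots \ge H_k=H'$ with $F<H_i<G$ for all $i$. Elements are called faces; faces of rank $0$ are vertices and faces of rank $n-1$ are facets. Two flags are adjacent if they differ in exactly one face. For $F\le G$ the section $G/F$ is $\{H: F\le H\le G\}$. A facet $F$ is identified with the $(n-1)$-polytope $F/F_{-1}$, and the vertex-figure at a vertex $v$ is the $(n-1)$-polytope $F_n/v$. An isomorphism of polytopes is a rank- and order-preserving bijection; $\Gamma(\mathcal{P})$ denotes the automorphism group. $\mathcal{P}$ is regular if $\Gamma(\mathcal{P})$ acts transitively on flags, and chiral if the flags form exactly two orbits under $\Gamma(\mathcal{P})$ with adjacent flags always lying in different orbits. A polytope is flat if every facet is incident with (i.e. comparable to) every vertex. *)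

(* Defs.v *)
From HB Require Import structures.
From mathcomp Require Import all_boot all_order all_algebra.
From mathcomp Require Import boolp classical_sets functions cardinality.

Set Implicit Arguments.
Unset Strict Implicit.
Unset Printing Implicit Defensive.

Import Order.TTheory GRing.Theory Num.Theory.
Local Open Scope classical_set_scope.
Local Open Scope card_scope.
Local Open Scope order_scope.

Section RankedPosets.
Context {d : Order.disp_t} {T : porderType d}.
Implicit Types (Phi Psi C : set T) (x y F G H : T).

Definition chain C : Prop := forall x y, C x -> C y -> x >=< y.

Definition flag Phi : Prop :=
  chain Phi /\ forall C, chain C -> Phi `<=` C -> C = Phi.

(* The rank of x is one less than the number of faces strictly below x in a
   flag through x; when all flags have the same finite length, this number is
   the same for all flags through x.  If no flag through x has finitely many
   faces below x, the value is the junk value 0. *)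
Definition rank x : int :=
  xget (0 : int) [set r : int | exists Phi (m : nat),
    [/\ flag Phi, Phi x, Phi `&` [set y | y < x] #= `I_m
      & r = (m%:Z - 1)%R]].

Definition strictly_between F G H : Prop := F < H /\ H < G.

Definition diamond : Prop :=
  forall F G, F < G -> (rank G - rank F = 2%:Z)%R ->
    [set H | strictly_between F G H] #= `I_2.

Definition strongly_connected : Prop :=
  forall F G H H', F < G -> (3%:Z <= rank G - rank F)%R ->
    strictly_between F G H -> strictly_between F G H' ->
    exists (k : nat) (c : nat -> T),
      [/\ c 0%N = H, c k = H',
          (forall i, (i <= k)%N -> strictly_between F G (c i))
        & forall i, (i < k)%N ->
            if odd i then c i >= c i.+1 else c i <= c i.+1].

Definition adjacent Phi Psi : Prop :=
  exists x y, Phi `\` Psi = [set x] /\ Psi `\` Phi = [set y].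

Definition facet (n : int) F : Prop := rank F = (n - 1)%R.

Definition vertex x : Prop := rank x = 0%R.

Definition flat (n : int) : Prop :=
  forall F v, facet n F -> vertex v -> F >=< v.

(* The section G / F. *)
Definition section F G : Type := {H : T | F <= H <= G}.

HB.instance Definition _ F G := Choice.on (section F G).
HB.instance Definition _ F G := SubType.on (section F G).
HB.instance Definition _ F G :=
  [SubChoice_isSubPOrder of section F G by <: with d].

End RankedPosets.

Arguments flat {d} T n.
Arguments diamond {d} T.
Arguments strongly_connected {d} T.

(* The least face is \bot and the greatest face is \top.  An n-polytope has
   ranks -1, ..., n, hence n + 2 faces in each flag; n is an integer so that
   rank -1 (the one-element poset) is allowed. *)
Record is_polytope (n : int) {d : Order.disp_t} (T : tbPOrderType d) : Prop :=
  IsPolytope {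
    polytope_flag_length : forall Phi : set T, flag Phi ->
      exists m : nat, Phi #= `I_m /\ (m%:Z = n + 2)%R;
    polytope_diamond : diamond T;
    polytope_strongly_connected : strongly_connected T }.

Definition isomorphism {d d' : Order.disp_t} (T : porderType d)
    (T' : porderType d') (f : T -> T') : Prop :=
  [/\ bijective f, {mono f : x y / x <= y}
    & forall x, rank (f x) = rank x].

Definition isomorphic {d d' : Order.disp_t} (T : porderType d)
    (T' : porderType d') : Prop :=
  exists f : T -> T', isomorphism f.

Section Symmetry.
Context {d : Order.disp_t} (T : porderType d).
Implicit Types Phi Psi : set T.

Definition flag_orbit Phi : set (set T) :=
  [set Psi | exists2 g : T -> T, isomorphism g & g @` Phi = Psi].

Definition regular : Prop :=
  forall Phi Psi, flag Phi -> flag Psi -> flag_orbit Phi Psi.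

Definition chiral : Prop :=
  [set flag_orbit Phi | Phi in flag] #= `I_2 /\
  forall Phi Psi, flag Phi -> flag Psi -> adjacent Phi Psi ->
    flag_orbit Phi <> flag_orbit Psi.

End Symmetry.

(* Main.v *)
(* Let r_i send a flag to its i-adjacent flag; P is regular as soon as every word
   in the r_i that fixes one flag fixes all of them.  Since K is regular, a word
   in r_0, ..., r_(n-2) acts on all flags "in the same way", and likewise, L being
   regular, a word in r_1, ..., r_(n-1).  Since K is flat, a word in
   r_0, ..., r_(n-2) acts like c s with c in r_1, ..., r_(n-2) and s in
   r_0, ..., r_(n-3); as s commutes with r_(n-1), every word acts like some b a
   with b in r_1, ..., r_(n-1) and a in r_0, ..., r_(n-2).  If b a fixes a flag f,
   then f and f b share both their vertex and their facet, so b acts like a word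
   c in r_1, ..., r_(n-2), and c a, a word of the facet, fixes f, hence every flag.
   So P is regular, hence not chiral. *)
Require Import Defs.
From mathcomp Require Import all_boot all_order all_algebra.
From mathcomp Require Import boolp classical_sets functions cardinality.
From mathcomp Require Import zify.

Set Implicit Arguments.
Unset Strict Implicit.
Unset Printing Implicit Defensive.

Import Order.TTheory GRing.Theory Num.Theory.
Local Open Scope card_scope.
Local Open Scope order_scope.
Local Open Scope classical_set_scope.

(** * Finite sets as duplicate-free lists *)

Lemma card_set_seq (T : choiceType) (s : seq T) :
  uniq s -> [set` s] #= `I_(size s).
Proof.
case: s => [|x0 s0 us]; first by rewrite set_nil /= II0.
set s := x0 :: s0 in us *.
have -> : [set` s] = nth x0 s @` `I_(size s).
  apply/seteqP; split=> [x /= /(nthP x0)[i si <-]|_ [i /= si <-]].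
    by exists i.
  exact: mem_nth.
apply: inj_card_eq => i j; rewrite !inE /= => si sj /eqP.
by rewrite nth_uniq// => /eqP.
Qed.

Lemma card_eq_I_seq (T : choiceType) (A : set T) m :
  A #= `I_m -> exists2 s, uniq s & size s = m /\ A = [set` s].
Proof.
move=> Am; have /finite_seqP[s0 As] : finite_set A.
  by apply/finite_setP; exists m.
have {}As : A = [set` undup s0].
  by rewrite As; apply/seteqP; split=> x /=; rewrite mem_undup.
exists (undup s0); rewrite ?undup_uniq//; split=> //.
apply/card_eq_II/(card_eq_trans _ Am).
by rewrite As card_eq_sym card_set_seq ?undup_uniq.
Qed.

Lemma card_eq_I2 (T : choiceType) (A : set T) :
  A #= `I_2 -> exists x y, x <> y /\ A = [set x; y].
Proof.
move=> /card_eq_I_seq[[|x [|y [|? ?]]] /= + [//= _ ->]].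
rewrite andbT inE => /eqP xy.
exists x, y; split=> //; apply/seteqP; split=> z /=; rewrite !inE.
  by case/orP=> /eqP; [left|right].
by case=> ->; rewrite eqxx ?orbT.
Qed.

(** * Maximal chains in a partial order *)

Section Flags.
Context {d : Order.disp_t} {T : porderType d}.
Implicit Types (Phi C : set T) (x y : T) (s : seq T).

Lemma chain_sub_flag C : chain C -> exists2 Phi, flag Phi & C `<=` Phi.
Proof.
move=> chC.
(* Zorn is applied to the sets whose union with [C] is a chain, not to the chains containing [C]:
   the union of the empty family must qualify too. *)
have [F FP Ftot|A [chA Amax]] := @Zorn_bigcup T [set A | chain (A `|` C)].
  move=> x y [[X FX Xx]|Cx] [[Y FY Yy]|Cy].
  - have [XY|YX] := Ftot _ _ FX FY.
      by apply: (FP _ FY); left=> //; apply: XY.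
    by apply: (FP _ FX); left=> //; apply: YX.
  - by apply: (FP _ FX); [left|right].
  - by apply: (FP _ FY); [right|left].
  - exact: chC.
exists (A `|` C); last by move=> x; right.
split=> // B chB AB; apply/seteqP; split=> // x Bx; apply: contrapT => nx.
apply: (Amax B).
  by split=> [y Ay|/(_ x Bx) Ax]; [apply: AB; left|apply: nx; left].
rewrite /= (_ : B `|` C = B)//.
by apply/setUidPl => y Cy; apply: AB; right.
Qed.

Lemma flagP Phi :
  flag Phi <-> chain Phi /\ forall y, (forall x, Phi x -> x >=< y) -> Phi y.
Proof.
split=> [[chP maxP]|[chP maxP]]; split=> //.
  move=> y cy; rewrite -(maxP (y |` Phi)); [by left| |by move=> x; right].
  move=> u v [->|Pu] [->|Pv]; [exact: comparablexx| |exact: cy|exact: chP].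
  by rewrite comparable_sym; apply: cy.
move=> C chC PC; apply/seteqP; split=> // y Cy.
by apply: maxP => x Px; apply: chC => //; apply: PC.
Qed.

Lemma lt_sorted_cat_cons s1 x s2 :
  sorted <%O (s1 ++ x :: s2) =
    [&& sorted <%O s1, sorted <%O s2, all (< x) s1, all (> x) s2 &
        allrel <%O s1 s2].
Proof.
rewrite !lt_sorted_pairwise pairwise_cat allrel_consr /=.
rewrite -!andbA; do !bool_congr.
Qed.

Lemma flag_sorted_seq Phi m : chain Phi -> Phi #= `I_m ->
  exists2 s, sorted <%O s & size s = m /\ Phi = [set` s].
Proof.
move=> chP /card_eq_I_seq[s us [sm Ps]].
have tot : {in s &, total (<=%O : rel T)}.
  by move=> x y xs ys; apply: chP; rewrite Ps.
have srt : sorted <=%O (sort <=%O s) by apply: sort_sorted_in tot _ _; apply/allP.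
exists (sort <=%O s); first by rewrite lt_sorted_uniq_le sort_uniq us.
rewrite size_sort; split=> //.
by rewrite Ps; apply/seteqP; split=> x /=; rewrite mem_sort.
Qed.

Lemma lt_sorted_chain s : sorted <%O s -> chain [set` s].
Proof.
move=> ss x y /= xs ys; rewrite -(nth_index x xs) -(nth_index x ys).
have mono := lt_sorted_leq_nth x ss.
rewrite /Order.comparable; case: (leqP (index x s) (index y s)) => [ij|/ltnW ij].
  by apply/orP; left; rewrite mono // inE index_mem.
by apply/orP; right; rewrite mono // inE index_mem.
Qed.

(** A face [y] comparable to the spliced chain is comparable to [x]. If it lies below [x], it is
    comparable to all of the first flag, hence belongs to it; if above, the same holds with the
    second flag. This is what makes ranks independent of the flag. *)
Lemma flag_splice s1 s2 t1 t2 x :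
  sorted <%O (s1 ++ x :: s2) -> flag [set` s1 ++ x :: s2] ->
  sorted <%O (t1 ++ x :: t2) -> flag [set` t1 ++ x :: t2] ->
  sorted <%O (s1 ++ x :: t2) /\ flag [set` s1 ++ x :: t2].
Proof.
move=> ss fs st ft.
have sst : sorted <%O (s1 ++ x :: t2).
  move: ss st; rewrite !lt_sorted_cat_cons.
  move=> /and5P[-> _ s1x _ _] /and5P[_ -> _ xt2 _]; rewrite s1x xt2 /=.
  apply/allrelP => u v us vt.
  exact: lt_trans (allP s1x _ us) (allP xt2 _ vt).
split=> //; apply/flagP; split; first exact: lt_sorted_chain.
move=> y cy.
have cs u : u \in s1 -> u >=< y by move=> us; apply: cy; rewrite /= mem_cat us.
have ct u : u \in t2 -> u >=< y.
  by move=> us; apply: cy; rewrite /= mem_cat inE us !orbT.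
have cx : x >=< y by apply: cy; rewrite /= mem_cat inE eqxx orbT.
move: ss st; rewrite !lt_sorted_cat_cons.
move=> /and5P[_ _ s1x xs2 _] /and5P[_ _ t1x xt2 _].
have [yx|xy] : y <= x \/ x <= y by case/orP: cx; [right|left].
  have /= : [set` s1 ++ x :: s2] y.
    apply/(proj2 (proj1 (flagP _) fs)) => u; rewrite /= mem_cat inE.
    case/or3P=> [/cs//|/eqP->//|/(allP xs2)/= xu].
    by rewrite comparable_sym; apply/le_comparable/(le_trans yx)/ltW.
  rewrite !mem_cat !inE => /or3P[->//|->|/(allP xs2)/= xy]; first by rewrite orbT.
  by have := lt_le_trans xy yx; rewrite ltxx.
have /= : [set` t1 ++ x :: t2] y.
  apply/(proj2 (proj1 (flagP _) ft)) => u; rewrite /= mem_cat inE.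
  case/or3P=> [/(allP t1x)/= ux|/eqP->//|/ct//].
  by apply/le_comparable/(le_trans _ xy)/ltW.
rewrite !mem_cat !inE => /or3P[/(allP t1x)/= yx|->|->]; rewrite ?orbT//.
by have := lt_le_trans yx xy; rewrite ltxx.
Qed.

End Flags.

(** The flag extending the empty chain contains [\bot], so its length [n + 2] is positive. Writing
    [M] for [n + 1] allows natural numbers as ranks. *)
Lemma polytope_dim (n : int) d (T : tbPOrderType d) :
  is_polytope n T -> exists M, n = (M%:Z - 1)%R.
Proof.
move=> polyT; have [Phi fP _] : exists2 Phi : set T, flag Phi & set0 `<=` Phi.
  exact: chain_sub_flag.
have [[|m] [Pm mn]] := polytope_flag_length polyT fP; last by exists m; lia.
have : Phi \bot.
  apply/(proj2 (proj1 (flagP _) fP)) => x _.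
  by rewrite comparable_sym; apply/le_comparable/le0x.
by move: Pm; rewrite II0 card_eq0 => /eqP ->.
Qed.

(** * Ranks, flags as sequences indexed by rank, and flips to adjacent flags *)

Section Polytope.
Context {d : Order.disp_t} {T : tbPOrderType d} {M : nat}.
Hypothesis polyT : is_polytope (M%:Z - 1)%R T.
Implicit Types (Phi C : set T) (x y : T) (s : seq T).

Lemma flag_seq Phi : flag Phi ->
  exists2 s, sorted <%O s & size s = M.+1 /\ Phi = [set` s].
Proof.
move=> fP; have [m [Pm mn]] := polytope_flag_length polyT fP.
have -> : M.+1 = m by lia.
by apply: flag_sorted_seq => //; case: fP.
Qed.

Lemma sorted_flag_size s : sorted <%O s -> flag [set` s] -> size s = M.+1.
Proof.
move=> ss fs; have [t st [tM /seteqP[sub1 sub2]]] := flag_seq fs.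
rewrite -tM; apply/perm_size/uniq_perm; rewrite ?lt_sorted_uniq//.
by move=> x; apply/idP/idP => [/sub1|/sub2].
Qed.

(** Given another flag [t1 ++ x :: t2], the splice [s1 ++ x :: t2] is a flag as well. All flags have
    [M.+1] faces, so [s1] and [t1] have the same length, and the choice made in [rank] is forced. *)
Lemma rankE s1 x s2 : sorted <%O (s1 ++ x :: s2) -> flag [set` s1 ++ x :: s2] ->
  rank x = ((size s1)%:Z - 1)%R.
Proof.
move=> ss fs.
have below t1 t2 : sorted <%O (t1 ++ x :: t2) ->
    [set` t1 ++ x :: t2] `&` [set y | y < x] #= `I_(size t1).
  move=> st; suff -> : [set` t1 ++ x :: t2] `&` [set y | y < x] = [set` t1].
    by apply/card_set_seq; move: st => /lt_sorted_uniq; rewrite cat_uniq => /andP[].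
  move: st; rewrite lt_sorted_cat_cons => /and5P[_ _ t1x xt2 _].
  apply/seteqP; split=> y /=; rewrite mem_cat inE.
    case=> /or3P[//|/eqP->|/(allP xt2)/= xy] yx; first by rewrite ltxx in yx.
    by have := lt_trans xy yx; rewrite ltxx.
  by move=> yt; rewrite yt; split=> //; apply: (allP t1x).
apply: xget_unique.
  exists [set` s1 ++ x :: s2], (size s1); split=> //; last exact: below.
  by rewrite /= mem_cat inE eqxx orbT.
move=> _ [Phi [m [fP Px Pm ->]]].
have [t st [tM Pt]] := flag_seq fP.
have xt : x \in t by move: Px; rewrite Pt.
case/splitPr: xt st Pt tM => t1 t2 st Pt tM.
have [st' ft'] := flag_splice ss fs st (eq_ind _ _ fP _ Pt).
have := sorted_flag_size st' ft'.
rewrite size_cat -tM size_cat /= => /eqP; rewrite eqn_add2r => /eqP ->.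
congr (_%:Z - 1)%R; apply/card_eq_II.
by have := below _ _ st; rewrite -Pt; apply: card_eq_trans; rewrite card_eq_sym.
Qed.


(* Ranks are shifted by one from here on, so that they range over 0, ..., M. *)
Definition rk x : nat := `|(rank x + 1)%R|%N.

Lemma rk_cat s1 x s2 : sorted <%O (s1 ++ x :: s2) -> flag [set` s1 ++ x :: s2] ->
  rk x = size s1.
Proof. by move=> ss fs; rewrite /rk (rankE ss fs) subrK. Qed.

Lemma rk_nth s k : sorted <%O s -> flag [set` s] -> (k < size s)%N ->
  rk (nth \top s k) = k.
Proof.
move=> ss fs ks; rewrite (@rk_cat (take k s) _ (drop k.+1 s)).
- by rewrite size_takel// ltnW.
- by rewrite -drop_nth// cat_take_drop.
- by rewrite -drop_nth// cat_take_drop.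
Qed.

Lemma chain_seq C : chain C ->
  exists2 s, sorted <%O s & [/\ size s = M.+1, flag [set` s] & C `<=` [set` s]].
Proof.
move=> /chain_sub_flag[Phi fP CP]; have [s ss [sM Ps]] := flag_seq fP.
by exists s => //; rewrite -Ps.
Qed.

Lemma chain2 x y : x <= y -> chain [set x; y].
Proof.
move=> xy u v [->|->] [->|->]; rewrite ?comparablexx//.
- exact: le_comparable.
- by rewrite comparable_sym; apply: le_comparable.
Qed.

Lemma rank_rk x : rank x = ((rk x)%:Z - 1)%R.
Proof.
have [s ss [sM fs sub]] := chain_seq (chain2 (lexx x)).
have xs : x \in s by apply: sub; left.
by case/splitPr: xs ss fs {sM sub} => s1 s2 ss fs; rewrite (rk_cat ss fs) (rankE ss fs).
Qed.

(* A flag listed by increasing rank, padded with the greatest face. *)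
Definition sflag (f : nat -> T) :=
  (forall k, rk (f k) = minn k M) /\ forall k, f k <= f k.+1.

Lemma sflag_through x y : x <= y ->
  exists f, [/\ sflag f, f (rk x) = x & f (rk y) = y].
Proof.
move=> xy; have [s ss [sM fs sub]] := chain_seq (chain2 xy).
have rkE z : z \in s -> nth \top s (minn (rk z) M) = z.
  move=> zs; rewrite -{1}(nth_index \top zs) rk_nth ?index_mem//.
  rewrite (minn_idPl _) ?nth_index//.
  by rewrite -ltnS -sM index_mem.
exists (fun k => nth \top s (minn k M)); split.
- split=> k; first by rewrite rk_nth// sM ltnS geq_minr.
  by rewrite (lt_sorted_leq_nth _ ss) ?inE ?sM ?ltnS ?geq_minr//; lia.
- by apply/rkE/sub; left.
- by apply/rkE/sub; right.
Qed.

Lemma sflag_homo f : sflag f -> {homo f : i j / (i <= j)%N >-> i <= j}.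
Proof. by case=> _ fS; apply: homo_leq => // ? ? ?; apply: le_trans. Qed.

Lemma rk_homo : {homo rk : x y / x < y >-> (x < y)%N}.
Proof.
move=> x y xy; have [f [sf fx fy]] := sflag_through (ltW xy).
rewrite ltnNge; apply/negP => /(sflag_homo sf).
by rewrite fx fy => /(lt_le_trans xy); rewrite ltxx.
Qed.

Lemma rk_le : {homo rk : x y / x <= y >-> (x <= y)%N}.
Proof. by move=> x y; rewrite le_eqVlt => /orP[/eqP->//|/rk_homo/ltnW]. Qed.

Lemma rk_inj_comparable x y : x >=< y -> rk x = rk y -> x = y.
Proof.
by case/comparable_ltgtP => // /rk_homo + e; rewrite e ltnn.
Qed.

Lemma rk_bot : rk \bot = 0%N.
Proof.
have [f [[rkf _] fx _]] := sflag_through (le0x \top).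
apply/eqP; rewrite -leqn0; have := rkf 0%N; rewrite min0n => <-.
exact/rk_le/le0x.
Qed.

Lemma rk_top : rk \top = M.
Proof.
have [f [[rkf _] _ fx]] := sflag_through (le0x \top).
apply/eqP; rewrite eqn_leq; apply/andP; split; first by rewrite -fx rkf geq_minr.
by have := rkf M; rewrite minnn => {1}<-; apply/rk_le/lex1.
Qed.

Lemma rk_leM x : (rk x <= M)%N.
Proof. by rewrite -rk_top; apply/rk_le/lex1. Qed.

Lemma sflag0 f : sflag f -> f 0%N = \bot.
Proof.
case=> rkf _; apply/rk_inj_comparable; last by rewrite rkf min0n rk_bot.
by rewrite comparable_sym; apply/le_comparable/le0x.
Qed.

Lemma sflagM f k : sflag f -> (M <= k)%N -> f k = \top.
Proof.
case=> rkf _ Mk; apply/rk_inj_comparable; last by rewrite rkf rk_top; apply/minn_idPr.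
exact/le_comparable/lex1.
Qed.

Lemma sflag_lt f : sflag f -> forall i j, (i < j)%N -> (i < M)%N -> f i < f j.
Proof.
move=> sf i j ij iM; rewrite lt_neqAle sflag_homo ?(ltnW ij)// andbT.
by apply/eqP => /(congr1 rk); rewrite !(proj1 sf); lia.
Qed.

Lemma sflag_range f : sflag f -> flag (range f).
Proof.
move=> sf; apply/flagP; split=> [_ _ [i _ <-] [j _ <-]|y cy].
  case: (leqP i j) => [ij|/ltnW ij].
    exact/le_comparable/sflag_homo.
  by rewrite comparable_sym; apply/le_comparable/sflag_homo.
exists (rk y) => //; apply: rk_inj_comparable; first by apply: cy; exists (rk y).
by rewrite (proj1 sf); apply/minn_idPl/rk_leM.
Qed.

Lemma flag_sflag Phi : flag Phi -> exists2 f, sflag f & Phi = range f.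
Proof.
move=> fP; have [s ss [sM Ps]] := flag_seq fP.
have fs : flag [set` s] by rewrite -Ps.
have sf : sflag (fun k => nth \top s (minn k M)).
  split=> k; first by rewrite rk_nth// sM ltnS geq_minr.
  by rewrite (lt_sorted_leq_nth _ ss) ?inE ?sM ?ltnS ?geq_minr//; lia.
eexists; first exact: sf.
apply: (proj2 (sflag_range sf)); first by case: fP.
by move=> _ [k _ <-]; rewrite Ps /= mem_nth// sM ltnS geq_minr.
Qed.

(* When nothing but x lies strictly between a and b, this is x; thus flip i is
   the identity on flags unless 0 < i < M. *)
Definition other a x b : T := xget x [set y | [/\ a < y, y < b & y <> x]].

Definition flip i (f : nat -> T) k :=
  if k == i then other (f i.-1) (f i) (f i.+1) else f k.

Lemma sflag_diamond f i : sflag f -> (0 < i < M)%N ->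
  exists2 y, y <> f i & [/\ f i.-1 < y, y < f i.+1 &
    forall z, f i.-1 < z -> z < f i.+1 -> z = f i \/ z = y].
Proof.
move=> sf iM; have ltf := sflag_lt sf.
have l1 : f i.-1 < f i by apply: ltf; lia.
have l2 : f i < f i.+1 by apply: ltf; lia.
have : (rank (f i.+1) - rank (f i.-1) = 2%:Z)%R.
  by rewrite !rank_rk !(proj1 sf); lia.
move=> /(polytope_diamond polyT (lt_trans l1 l2))/card_eq_I2[x [y [xy /seteqP[E1 E2]]]].
have [fx|fy] := E1 (f i) (conj l1 l2).
  have [y1 y2] := E2 y (or_intror erefl).
  exists y; rewrite fx; first by move/esym.
  by split=> // z z1 z2; apply: E1.
have [x1 x2] := E2 x (or_introl erefl).
exists x; rewrite fy//.
by split=> // z z1 z2; have [] := E1 z (conj z1 z2); [right|left].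
Qed.

(** Counting ranks is enough: for [i = 0] and for [M <= i], the ranks of the faces at [i.-1] and
    [i.+1] differ by at most one. *)
Lemma between_range f i y : sflag f -> f i.-1 < y -> y < f i.+1 ->
  (0 < i < M)%N /\ rk y = i.
Proof. by move=> sf /rk_homo + /rk_homo; rewrite !(proj1 sf); lia. Qed.

Lemma flip_eq f i y : sflag f -> f i.-1 < y -> y < f i.+1 -> y <> f i ->
  flip i f i = y.
Proof.
move=> sf y1 y2 yf; have [iM _] := between_range sf y1 y2.
have [z zf [_ _ zP]] := sflag_diamond sf iM.
have yz : y = z by case: (zP _ y1 y2).
rewrite /flip eqxx; apply: xget_unique => // u [u1 u2 uf].
by case: (zP _ u1 u2) => //; rewrite yz.
Qed.

Lemma flip_sflag i f : sflag f -> sflag (flip i f).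
Proof.
move=> sf; have [rkf fS] := sf.
suff [e le1 le2] : [/\ rk (flip i f i) = minn i M, f i.-1 <= flip i f i
    & flip i f i <= f i.+1].
  split=> k.
    by have [->//|ki] := eqVneq k i; rewrite /flip (negPf ki).
  have [->|ki] := eqVneq k i; first by rewrite {2}/flip gtn_eqF.
  rewrite {1}/flip (negPf ki); have [e'|ki'] := eqVneq k.+1 i.
    by rewrite e'; apply: le_trans le1; rewrite -e'.
  by rewrite /flip (negPf ki').
rewrite /flip eqxx /other; case: xgetP => [y _ [y1 y2 _]|_].
  have [iM ->] := between_range sf y1 y2.
  by split; rewrite ?ltW//; lia.
by split=> //; apply: sflag_homo => //; lia.
Qed.

(** A difference at [i] forces [0 < i < M], since all flags share their faces at 0 and from [M] on;
    the diamond condition then leaves a single candidate. *)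
Lemma flipP i f h : sflag f -> sflag h -> (forall k, k != i -> h k = f k) ->
  h i <> f i -> flip i f = h.
Proof.
move=> sf sh hf hi.
have i0 : (0 < i)%N.
  by case: i hf hi => // _; rewrite !sflag0.
have iM : (i < M)%N.
  by rewrite ltnNge; apply/negP => Mi; apply: hi; rewrite !sflagM.
apply/funext => k; have [->|ki] := eqVneq k i; last by rewrite hf// /flip (negPf ki).
apply: flip_eq => //; rewrite -hf; try (apply: sflag_lt => //); lia.
Qed.

Lemma flip_neq i f : sflag f -> (0 < i < M)%N -> flip i f i <> f i.
Proof.
move=> sf iM; have [y yf [y1 y2 _]] := sflag_diamond sf iM.
by rewrite (flip_eq sf y1 y2 yf).
Qed.

Lemma flipK i f : sflag f -> flip i (flip i f) = f.
Proof.
move=> sf; have [e|ne] := pselect (flip i f i = f i).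
  suff -> : flip i f = f.
    apply/funext => k; rewrite /flip; case: eqP => // ->.
    by move: e; rewrite /flip eqxx.
  by apply/funext => k; have [->//|ki] := eqVneq k i; rewrite /flip (negPf ki).
apply: flipP => //; [exact: flip_sflag| |by move/esym].
by move=> k ki; rewrite /flip (negPf ki).
Qed.

(** A flip at [j] reads only the positions [j.-1], [j] and [j.+1], none of which is [i], and
    conversely. *)
Lemma flipC i j f : (i.+1 < j)%N -> flip i (flip j f) = flip j (flip i f).
Proof.
move=> ij; apply/funext => k; rewrite /flip.
have /negPf -> : i.-1 != j by lia.
have /negPf -> : i != j by lia.
have /negPf -> : i.+1 != j by lia.
have /negPf -> : j.-1 != i by lia.
have /negPf -> : j != i by lia.
have /negPf -> : j.+1 != i by lia.
by case: (eqVneq k i) => // ->; case: eqVneq => // ij'; lia.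
Qed.

(** * Words of flips, strong connectivity, and rigid sections *)

Definition act (f : nat -> T) (w : seq nat) := foldl (fun h i => flip i h) f w.

Lemma act_cat f v w : act f (v ++ w) = act (act f v) w.
Proof. exact: foldl_cat. Qed.

Lemma act_sflag f w : sflag f -> sflag (act f w).
Proof. by elim: w f => //= i w IH f sf; apply/IH/flip_sflag. Qed.

Lemma act_revK f w : sflag f -> act (act f w) (rev w) = f.
Proof.
elim: w f => //= i w IH f sf.
rewrite rev_cons -cats1 act_cat IH; last exact: flip_sflag.
exact: flipK.
Qed.

Lemma act_notin f w k : k \notin w -> act f w k = f k.
Proof.
elim: w f => //= i w IH f; rewrite inE negb_or => /andP[ki kw].
by rewrite IH// /flip (negPf ki).
Qed.

(** Since ranks are shifted by one, [flip i.+1] is the r_i of the overview. Words of the polytope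
    are thus [letters 0 M], those of a facet [letters 0 M.-1], those of a vertex-figure
    [letters 1 M]. *)
Definition letters a b (w : seq nat) := all (fun i => a < i < b)%N w.

Lemma letters_notin a b w k : letters a b w -> ((k <= a) || (b <= k))%N ->
  k \notin w.
Proof. by move=> /allP wab kab; apply/negP => /wab; lia. Qed.

Lemma letters_widen a b a' b' w : (a' <= a)%N -> (b <= b')%N ->
  letters a b w -> letters a' b' w.
Proof. by move=> aa bb; apply: sub_all => i; lia. Qed.

Lemma letters_cat a b v w : letters a b (v ++ w) = letters a b v && letters a b w.
Proof. exact: all_cat. Qed.

Lemma splice_sflag i f h : sflag f -> sflag h -> f i = h i ->
  sflag (fun k => if (k <= i)%N then f k else h k).
Proof.
move=> [rkf fS] [rkh hS] e; split=> k; first by case: ifP.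
by have [ki|ki|->] := ltngtP k i => //; rewrite e.
Qed.

(** The flag follows [f] up to [f a], then a flag through [f a] and [x], then one through [x] and
    [f b], then [f] again. The auxiliary facts [fax] and [fbx] settle the cases where [x] is one of
    the ends. *)
Lemma sflag_insert f a b x : sflag f -> (a <= b <= M)%N -> f a <= x -> x <= f b ->
  exists h, [/\ sflag h, h (rk x) = x &
    forall k, ((k <= a) || (b <= k))%N -> h k = f k].
Proof.
move=> sf abM ax xb; have rkf := proj1 sf.
have [p [sp pa px]] := sflag_through ax.
have [q [sq qx qb]] := sflag_through xb.
have rka : rk (f a) = a by rewrite rkf; lia.
have rkb : rk (f b) = b by rewrite rkf; lia.
rewrite rka in pa; rewrite rkb in qb.
have ax' := rk_le ax; have bx' := rk_le xb.
rewrite rka in ax'; rewrite rkb in bx'.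
have fax : (rk x <= a)%N -> f (rk x) = x.
  by move=> xa; have e : rk x = a by [lia]; move: px; rewrite e pa.
have fbx : (b <= rk x)%N -> f b = x.
  by move=> bx; have e : rk x = b by [lia]; move: qx; rewrite e qb.
have s1 := splice_sflag sf sp (esym pa).
have s2 : sflag (fun k =>
    if (k <= rk x)%N then if (k <= a)%N then f k else p k else q k).
  by apply: splice_sflag => //; rewrite qx; case: ifP.
eexists; split; first apply: (splice_sflag (i := b) s2 sf).
- case: ifP => bx; last exact: qb.
  by case: ifP => [//|_]; rewrite fbx// -[RHS]px; congr p; lia.
- by rewrite /= bx' leqnn; case: ifP.
move=> k /= /orP[ka|bk].
  by rewrite ka (leq_trans ka ax') (_ : (k <= b)%N)//; lia.
case: ifP => // kb; have -> : k = b by lia.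
case: ifP => // bx; case: ifP => // _.
by rewrite fbx// -[RHS]px; congr p; lia.
Qed.

Definition agree a b (f h : nat -> T) :=
  forall k, ((k <= a) || (b <= k))%N -> f k = h k.

Lemma act_agree a b f w : letters a b w -> agree a b f (act f w).
Proof. by move=> ab k kab; rewrite act_notin// (letters_notin ab). Qed.

Definition reach a b f h := exists2 w, letters a b w & act f w = h.

Lemma reach_trans a b f g h : reach a b f g -> reach a b g h -> reach a b f h.
Proof.
move=> [v vab <-] [w wab <-]; exists (v ++ w); rewrite ?act_cat//.
by rewrite letters_cat vab.
Qed.

(** The path goes through the flag that follows [f] up to rank [i] and [h] beyond: the first leg
    changes only ranks between [i] and [b], the second only ranks between [a] and [i], and both
    intervals are shorter. *)
Lemma reach_shared a b i f h :
  (forall a' b', (b' - a' < b - a)%N -> (b' <= M)%N -> forall f h,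
    sflag f -> sflag h -> agree a' b' f h -> reach a' b' f h) ->
  (a < i < b)%N -> (b <= M)%N -> sflag f -> sflag h -> agree a b f h -> f i = h i ->
  reach a b f h.
Proof.
move=> IH iab bM sf sh fh fhi.
pose g k := if (k <= i)%N then f k else h k.
have sg : sflag g by apply: splice_sflag.
have fg : agree i b f g.
  by move=> k; rewrite /g; case: ifP => //= _ bk; apply: fh; rewrite bk orbT.
have gh : agree a i g h.
  move=> k; rewrite /g; case: ifP => //= ki /orP[ka|ik]; first by rewrite fh// ka.
  by have -> : k = i by lia.
have [|v vib vg] := IH i b _ bM f g sf sg fg; first lia.
have [||w wai wh] := IH a i _ _ g h sg sh gh; try lia.
apply: (reach_trans (g := g)).
  by exists v => //; apply: letters_widen vib; lia.
by exists w => //; apply: letters_widen wai; lia.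
Qed.

(* Strong connectivity, in terms of flags: flags with the same faces of rank at
   most a and at least b are joined by flips of intermediate rank. *)
Lemma agree_reach a b f h : (b <= M)%N ->
  sflag f -> sflag h -> agree a b f h -> reach a b f h.
Proof.
have [m] := ubnP (b - a); elim: m => // m IHm in a b f h *.
move=> abm bM sf sh fh.
have IH a' b' : (b' - a' < b - a)%N -> (b' <= M)%N -> forall f h,
    sflag f -> sflag h -> agree a' b' f h -> reach a' b' f h.
  by move=> ab' bM' f' h'; apply: IHm => //; lia.
have [ab|ab] := leqP b a.+1.
  exists [::] => //; apply/funext => k; apply: fh; lia.
(* Only the rank [a.+1] is free, so [h] is [f] or its flip there. *)
have [ab2|{}ab] := leqP b a.+2.
  have [e|ne] := pselect (h a.+1 = f a.+1).
    exists [::] => //; apply/funext => k /=.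
    have [->//|ka] := eqVneq k a.+1; apply: fh; lia.
  exists [:: a.+1]; first by rewrite /letters /=; lia.
  by apply: flipP => // k ka; rewrite fh//; lia.
have ltf := sflag_lt sf; have lth := sflag_lt sh.
have fab : f a < f b by apply: ltf; lia.
have ea : h a = f a by rewrite fh// leqnn.
have eb : h b = f b by rewrite fh// leqnn orbT.
have Hf : strictly_between (f a) (f b) (f a.+1) by split; apply: ltf; lia.
have Hh : strictly_between (f a) (f b) (h a.+1).
  by rewrite -ea -eb; split; apply: lth; lia.
have [|k [c [c0 ck cb cS]]] := polytope_strongly_connected polyT fab _ Hf Hh.
  by rewrite !rank_rk !(proj1 sf); lia.
have rka : rk (f a) = a by rewrite (proj1 sf); lia.
have rkb : rk (f b) = b by rewrite (proj1 sf); lia.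
have rkc j : (j <= k)%N -> (a < rk (c j) < b)%N.
  by move=> /cb[/rk_homo + /rk_homo]; rewrite rka rkb => -> ->.
have share g g' i : sflag g -> sflag g' -> agree a b f g -> agree a b f g' ->
    (a < i < b)%N -> g i = g' i -> reach a b g g'.
  move=> sg sg' fg fg' iab gi; apply: (reach_shared IH iab) => // l lab.
  by rewrite -fg// fg'.
(* Strong connectivity yields faces [c 0], ..., [c k] leading from [f a.+1] to [h a.+1]. By
   induction along them, every flag through [c j] that agrees with [f] outside the interval is
   reached. *)
suff claim j : (j <= k)%N -> forall g, sflag g -> agree a b f g ->
    g (rk (c j)) = c j -> reach a b f g.
  apply: (claim k) => //; rewrite ck (proj1 sh) (minn_idPl _)//; lia.
elim: j => [_ g sg fg|j IHj jk g sg fg gc].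
  rewrite c0 (proj1 sf) (minn_idPl _); last by lia.
  move=> gc; apply: (share _ _ a.+1) => //; lia.
have : c j >=< c j.+1.
  have := cS j jk; case: ifP => _ le; last exact: le_comparable.
  by rewrite comparable_sym; apply: le_comparable.
(* Since [c j] and [c j.+1] are comparable, some flag [g'] contains both. It is reached by
   induction, and shares [c j.+1] with the target [g]. *)
move=> cc; suff [g' [sg' fg' g'1 g'2]] : exists g', [/\ sflag g', agree a b f g',
    g' (rk (c j)) = c j & g' (rk (c j.+1)) = c j.+1].
  apply: (reach_trans (IHj (ltnW jk) g' sg' fg' g'1)).
  by apply: (share _ _ (rk (c j.+1))) => //; [exact: rkc|rewrite g'2].
have ins x y : x <= y -> f a < x -> y < f b -> exists g', [/\ sflag g', agree a b f g',
    g' (rk x) = x & g' (rk y) = y].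
  move=> xy ax yb; have ax' := rk_homo ax; have yb' := rk_homo yb.
  have xy' := rk_le xy; rewrite rka in ax'; rewrite rkb in yb'.
  have [||p [sp px pf]] := sflag_insert (a := a) (b := b) sf _ (ltW ax).
  - by lia.
  - exact: le_trans xy (ltW yb).
  have [|||q [sq qy qp]] := @sflag_insert p (rk x) b y sp.
  - by lia.
  - by rewrite px.
  - by rewrite pf ?leqnn ?orbT// ltW.
  exists q; split=> //; last by rewrite qp ?leqnn.
  by move=> l lab; rewrite qp ?pf//; lia.
have [c1 c2] := cb j (ltnW jk); have [c3 c4] := cb j.+1 jk.
case/orP: cc => cc; first exact: ins.
by have [g' [? ? ? ?]] := ins _ _ cc c3 c2; exists g'.
Qed.

(** Flips of ranks between [a] and [b] stay inside the section from [f a] to [f b], so an order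
    embedding of this section suffices. It sends the new face of a flip to a face between the same
    neighbours of [h] and distinct from the old one, and there is only one such face. *)
Lemma act_local a b g f h w : (b <= M)%N -> letters a b w -> sflag f -> sflag h ->
  (forall u v, f a <= u <= f b -> f a <= v <= f b -> (g u <= g v) = (u <= v)) ->
  (forall k, (a <= k <= b)%N -> g (f k) = h k) ->
  forall k, (a <= k <= b)%N -> act h w k = g (act f w k).
Proof.
move=> bM.
elim: w f h => [|i w IH] f h /= wab sf sh gmono gfh k kab; first by rewrite gfh.
move: wab => /andP[iab wab].
have fa : flip i f a = f a by rewrite /flip; case: eqP => // ?; lia.
have fb : flip i f b = f b by rewrite /flip; case: eqP => // ?; lia.
have sfl := flip_sflag i sf.
apply: IH => //; try exact: flip_sflag; rewrite ?fa ?fb//.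
move=> l lab; have [->|li] := eqVneq l i; last by rewrite /flip (negPf li) gfh.
have inab j : (a <= j <= b)%N -> f a <= f j <= f b.
  by move=> jab; rewrite !(sflag_homo sf)//; lia.
have inab' : f a <= flip i f i <= f b.
  by rewrite -fa -fb !(sflag_homo sfl)//; lia.
have glt u v : f a <= u <= f b -> f a <= v <= f b -> u < v -> g u < g v.
  by move=> uab vab; rewrite !lt_leAnge !gmono.
have fne : flip i f i <> f i by apply: flip_neq => //; lia.
have e1 : flip i f i.-1 = f i.-1 by rewrite /flip; case: eqP => // ?; lia.
have e2 : flip i f i.+1 = f i.+1 by rewrite /flip; case: eqP => // ?; lia.
symmetry; apply: flip_eq => //; rewrite -gfh; try lia.
- by apply: glt; rewrite ?inab//; [lia|rewrite -e1; apply: sflag_lt => //; lia].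
- by apply: glt; rewrite ?inab//; [lia|rewrite -e2; apply: sflag_lt => //; lia].
move=> ge; apply: fne; apply/le_anti.
have inabi : f a <= f i <= f b by apply: inab; lia.
by rewrite -(gmono _ _ inab' inabi) -(gmono _ _ inabi inab') ge lexx.
Qed.

(** The form in which the regularity of a section is used: two words of the section that agree on
    one flag agree on all flags. *)
Definition rigid a b := forall f h v w, sflag f -> sflag h ->
  letters a b v -> letters a b w -> act f v = act f w -> act h v = act h w.

Lemma rigidP a b : (b <= M)%N ->
  (forall f h, sflag f -> sflag h -> exists2 g : T -> T,
    forall u v, f a <= u <= f b -> f a <= v <= f b -> (g u <= g v) = (u <= v) &
    forall k, (a <= k <= b)%N -> g (f k) = h k) ->
  rigid a b.
Proof.
move=> bM loc f h v w sf sh vab wab e; apply/funext => k.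
have [g gmono gfh] := loc _ _ sf sh.
have [kab|kab] := boolP (a <= k <= b)%N.
  by rewrite !(act_local bM _ sf sh gmono gfh)// e.
by rewrite -(act_agree _ vab) -1?(act_agree _ wab)//; lia.
Qed.

(** * Factoring words by flatness *)

Section Regularity.
Hypothesis M3 : (2 < M)%N.
Hypothesis rigid_facet : rigid 0 M.-1.
Hypothesis rigid_vertex : rigid 1 M.
Hypothesis flat_facet : forall x y z, rk x = 1%N -> rk y = M.-2 -> rk z = M.-1 ->
  x <= z -> y <= z -> x <= y.

Lemma exists_sflag : exists f : nat -> T, sflag f.
Proof. by have [f []] := sflag_through (lexx \bot); exists f. Qed.

(* Within a facet one first moves, around a fixed vertex, to the target ridge;
   flatness guarantees that this vertex lies on it. *)
Lemma factor_facet_word v : letters 0 M.-1 v -> exists c (s : seq nat),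
  [/\ letters 1 M.-1 c, letters 0 M.-2 s &
      forall f, sflag f -> act f v = act f (c ++ s)].
Proof.
move=> vM; have [f sf] := exists_sflag.
have sfv := act_sflag v sf; have fv := act_agree f vM.
set h := act f v in sfv fv.
(* The word [v] does not move the facet, so [f 1] and [h M.-2] lie in the same one and flatness
   applies. *)
have le1 : f 1%N <= h M.-2.
  apply: (flat_facet (z := f M.-1)).
  - by rewrite (proj1 sf); lia.
  - by rewrite (proj1 sfv); lia.
  - by rewrite (proj1 sf); lia.
  - by apply: (sflag_homo sf); lia.
  - by rewrite fv ?leqnn ?orbT//; apply: (sflag_homo sfv); lia.
(* The intermediate flag [g] keeps the vertex and facet of [f] and takes the ridge of [h]; [c] leads
   from [f] to [g], and [s] from [g] to [h]. *)
have [||g [sg gx gf]] := sflag_insert (a := 1) (b := M.-1) sf _ le1.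
- by lia.
- by rewrite fv ?leqnn ?orbT//; apply: (sflag_homo sfv); lia.
have rkh : rk (h M.-2) = M.-2 by rewrite (proj1 sfv); lia.
rewrite rkh in gx.
have [||c cM fc] := @agree_reach 1 M.-1 f g _ sf sg; first by lia.
  by move=> k kM; rewrite gf.
have [||s sM gs] := @agree_reach 0 M.-2 g h _ sg sfv; first by lia.
  move=> k; have [->//|kM] := eqVneq k M.-2.
  move=> kM'; rewrite gf; last by lia.
  by apply: fv; lia.
exists c, s; split=> // f' sf'; apply: rigid_facet sf sf' _ _ _ => //.
  by rewrite letters_cat (letters_widen _ _ cM) ?(letters_widen _ _ sM)//; lia.
by rewrite act_cat fc gs.
Qed.

Lemma flip_act_comm i (s : seq nat) f :
  letters 0 i.-1 s -> flip i (act f s) = act (flip i f) s.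
Proof.
elim: s f => //= j s IH f /andP[ji sM].
by rewrite IH// (@flipC j i)//; lia.
Qed.

(** Letters are appended on the right. One below [M.-1] joins [u]. For the letter [M.-1], [u] is
    rewritten as [c ++ s]; the letter commutes with [s], so [c] and the letter join [v], and [s]
    replaces [u]. *)
Lemma factor_word w : letters 0 M w -> exists v u,
  [/\ letters 1 M v, letters 0 M.-1 u &
      forall f, sflag f -> act f w = act f (v ++ u)].
Proof.
elim/last_ind: w => [_|w i IH]; first by exists [::], [::].
rewrite -cats1 letters_cat /= andbT => /andP[/IH[v [u [vM uM e]]] iM].
have [iM'|iM'] := ltnP i M.-1.
  exists v, (u ++ [:: i]); split=> //.
    by rewrite letters_cat uM /=; lia.
  by move=> f sf; rewrite catA !act_cat e// act_cat.
have -> : i = M.-1 by lia.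
have [c [s [cM sM e']]] := factor_facet_word uM.
exists (v ++ c ++ [:: M.-1]), s; split.
- rewrite !letters_cat vM (letters_widen _ _ cM)//=; lia.
- by apply: letters_widen sM; lia.
move=> f sf; rewrite act_cat e// !act_cat /= e'; last exact: act_sflag.
by rewrite act_cat flip_act_comm.
Qed.

Lemma flat_stab w f h : letters 0 M w -> sflag f -> sflag h ->
  act f w = f -> act h w = h.
Proof.
move=> wM sf sh; have [v [u [vM uM e]]] := factor_word wM.
rewrite !e// !act_cat => fvu.
have sfv := act_sflag v sf.
(* The vertex is shared because [v] fixes rank 1; the facet is shared because [u], which fixes rank
   [M.-1], brings [act f v] back to [f]. *)
have [||c cM fc] := @agree_reach 1 M.-1 f (act f v) _ sf sfv; first by lia.
  move=> k; have [k1 _|k1 /= kM] := leqP k 1; first by rewrite (act_agree _ vM)// k1.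
  by rewrite -[in LHS]fvu -(act_agree _ uM)// kM orbT.
rewrite -(rigid_vertex sf sh _ vM fc); last by apply: letters_widen cM; lia.
rewrite -act_cat (rigid_facet sf sh (w := [::]))//.
  by rewrite letters_cat uM (letters_widen _ _ cM)//; lia.
by rewrite act_cat fc.
Qed.
End Regularity.

(** The only possible letter is 1, so a word acts as a power of one involution. As [flip 1] moves
    every flag when [1 < M], a word fixing a flag has even length and acts trivially. *)
Lemma low_rank_stab w f h : (M <= 2)%N -> letters 0 M w -> sflag f -> sflag h ->
  act f w = f -> act h w = h.
Proof.
move=> M2 wM sf sh.
have wE : w = nseq (size w) 1%N.
  apply/all_pred1P; move: wM; apply: sub_all => i /=; lia.
have actE m g : sflag g -> act g (nseq m 1%N) = if odd m then flip 1 g else g.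
  elim: m g => //= m IHm g sg; rewrite IHm; last exact: flip_sflag.
  by rewrite flipK//; case: odd.
move: wM; rewrite wE !actE//; case: (size w) => //= m /andP[M1 _].
by case: ifP => // _ /(congr1 (@^~ 1%N)) e; case: (@flip_neq 1 f sf M1).
Qed.

(** * Automorphisms built from words *)

Section Transitivity.
Hypothesis act_stab : forall w f h, letters 0 M w -> sflag f -> sflag h ->
  act f w = f -> act h w = h.

Lemma letters_rev a b w : letters a b (rev w) = letters a b w.
Proof. exact: all_rev. Qed.

(* Two flags sharing their face of rank k are joined by flips of other ranks. *)
Lemma act_face f h v w k : letters 0 M v -> letters 0 M w -> (k <= M)%N ->
  sflag f -> sflag h -> act f v k = act f w k -> act h v k = act h w k.
Proof.
move=> vM wM kM sf sh e.
have sfv := act_sflag v sf; have sfw := act_sflag w sf.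
pose g j := if (j <= k)%N then act f v j else act f w j.
have sg : sflag g by apply: splice_sflag.
have [||s sM fg] := @agree_reach k M (act f v) g _ sfv sg; first by [].
  move=> j; rewrite /g; case: ifP => //= _ Mj.
  by rewrite (sflagM sfv Mj) (sflagM sfw Mj).
have [||t tM gf] := @agree_reach 0 k g (act f w) _ sg sfw; first by [].
  move=> j; rewrite /g leqn0 => /orP[/eqP->|kj]; first by rewrite leq0n !sflag0.
  by case: ifP => // jk; have -> : j = k by lia.
(* This word leads [f] to [act f v], to [g], to [act f w] and back, so it also fixes [h]. Since [s]
   and [t] leave rank [k] alone, [act h v] and [act h w] share their face there. *)
have := @act_stab (v ++ s ++ t ++ rev w) f h.
rewrite !letters_cat letters_rev vM wM.
rewrite (letters_widen _ _ sM)// (letters_widen _ _ tM)//.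
rewrite !act_cat fg gf act_revK// => /(_ isT sf sh erefl) /(congr1 (act^~ w)).
rewrite -[X in act (act _ _) X]revK act_revK; last by do 3 apply: act_sflag.
move=> <-; rewrite (@act_notin _ t) ?(@act_notin _ s)//.
  by apply: letters_notin sM _; rewrite leqnn.
by apply: letters_notin tM _; rewrite leqnn orbT.
Qed.

Lemma act_through f x y : sflag f -> x <= y -> exists2 w, letters 0 M w &
  act f w (rk x) = x /\ act f w (rk y) = y.
Proof.
move=> sf xy; have [g [sg gx gy]] := sflag_through xy.
have [||w wM e] := @agree_reach 0 M f g _ sf sg; first by [].
  move=> k; rewrite leqn0 => /orP[/eqP->|Mk]; first by rewrite !sflag0.
  by rewrite !sflagM.
by exists w => //; rewrite e.
Qed.

(** The automorphism carrying [f] to [h]: a word moving [f] to a flag through [x] is applied to [h],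
    and the face of the same rank is taken. For flags, such a word exists by [act_through], and its
    choice is immaterial by [act_face]. *)
Definition flag_map f h x : T := xget x [set y | exists2 w, letters 0 M w &
  act f w (rk x) = x /\ act h w (rk x) = y].

Lemma flag_mapE f h x w : sflag f -> sflag h -> letters 0 M w ->
  act f w (rk x) = x -> flag_map f h x = act h w (rk x).
Proof.
move=> sf sh wM wx; apply: xget_unique; first by exists w.
move=> _ [v vM [vx <-]].
by apply: (act_face vM wM (rk_leM x) sf sh); rewrite vx wx.
Qed.

Lemma rk_flag_map f h x : sflag f -> sflag h -> rk (flag_map f h x) = rk x.
Proof.
move=> sf sh; have [w wM [wx _]] := act_through sf (lexx x).
by rewrite (flag_mapE sf sh wM wx) (proj1 (act_sflag w sh)); apply/minn_idPl/rk_leM.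
Qed.

(** One word moves [f] to a flag through both faces, so their images lie in one flag. *)
Lemma flag_map_homo f h : sflag f -> sflag h -> {homo flag_map f h : x y / x <= y}.
Proof.
move=> sf sh x y xy; have [w wM [wx wy]] := act_through sf xy.
rewrite (flag_mapE sf sh wM wx) (flag_mapE sf sh wM wy).
exact/(sflag_homo (act_sflag w sh))/rk_le.
Qed.

Lemma flag_mapK f h : sflag f -> sflag h -> cancel (flag_map f h) (flag_map h f).
Proof.
move=> sf sh x; have [w wM [wx _]] := act_through sf (lexx x).
have e := flag_mapE sf sh wM wx; have rke := rk_flag_map x sf sh.
by rewrite (flag_mapE sh sf wM) rke.
Qed.

Lemma flag_map_iso f h : sflag f -> sflag h -> isomorphism (flag_map f h).
Proof.
move=> sf sh; split.
- by exists (flag_map h f); apply: flag_mapK.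
- move=> x y; apply/idP/idP => [|/flag_map_homo]; last exact.
  by move=> /(flag_map_homo sh sf); rewrite !flag_mapK.
- by move=> x; rewrite !rank_rk rk_flag_map.
Qed.

Lemma flag_map_flag f h : sflag f -> sflag h -> flag_map f h @` range f = range h.
Proof.
move=> sf sh.
have E k : flag_map f h (f k) = h k.
  have fk : f (minn k M) = f k.
    by have [//|Mk] := leqP k M; rewrite !sflagM// ltnW.
  have hk : h (minn k M) = h k.
    by have [//|Mk] := leqP k M; rewrite !sflagM// ltnW.
  by rewrite (@flag_mapE _ _ _ [::])//= (proj1 sf).
apply/seteqP; split=> [_ [_ [k _ <-] <-]|_ [k _ <-]]; first by rewrite E; exists k.
by exists (f k); [exists k|].
Qed.

Lemma flag_transitive : regular T.
Proof.
move=> Phi Psi /flag_sflag[f sf ->] /flag_sflag[h sh ->].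
by exists (flag_map f h); [apply: flag_map_iso|apply: flag_map_flag].
Qed.

End Transitivity.
End Polytope.

(** * Regularity excludes chirality *)

Lemma image_flag d d' (T : porderType d) (T' : porderType d') (g : T -> T') Phi :
  isomorphism g -> flag Phi -> flag (g @` Phi).
Proof.
move=> [[g' gK g'K] gm _] /flagP[chP maxP]; apply/flagP; split.
  by move=> _ _ [x Px <-] [y Py <-]; rewrite /Order.comparable !gm; apply: chP.
move=> y cy; exists (g' y) => //; apply: maxP => x Px.
by rewrite /Order.comparable -!gm g'K; apply: cy; exists x.
Qed.

(** Under regularity every orbit is the set of all flags, so there cannot be two. *)
Lemma regular_not_chiral d (T : porderType d) : regular T -> ~ chiral T.
Proof.
move=> regT [/card_eq_I2[A [B [AB /seteqP[_ E]]]] _]; apply: AB.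
have orbit (Phi : set T) : flag Phi -> flag_orbit Phi = flag.
  move=> fP; apply/seteqP; split=> [_ [g ig <-]|Psi fQ]; first exact: image_flag.
  exact: regT.
have [|Phi fP <-] := E A; first by left.
have [|Psi fQ <-] := E B; first by right.
by rewrite !orbit.
Qed.

(** * Sections of a polytope as polytopes *)

Arguments sflag {d T} M f.
Arguments rigid {d T} M a b.

(** Trades the subtype [section x y] for an order embedding of [X] whose image is the interval. *)
Lemma section_chart d d' (T : porderType d) (X : porderType d') (x y : T) :
  isomorphic (section x y) X -> exists2 q : X -> T, {mono q : u v / u <= v} &
    forall t, x <= t <= y <-> exists u, q u = t.
Proof.
move=> [phi [[psi phiK psiK] phi_mono _]].
exists (fun u => val (psi u)) => [u v|t].
  by have := phi_mono (psi u) (psi v); rewrite !psiK => ->.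
split=> [xty|[u <-]]; last exact: (valP (psi u)).
by exists (phi (exist _ t xty)); rewrite phiK.
Qed.

Section Charts.
Context {d d' : Order.disp_t} {T : tbPOrderType d} {X : tbPOrderType d'}.
Context {M N : nat} (q : X -> T) (x y : T).
Hypothesis polyT : is_polytope (M%:Z - 1)%R T.
Hypothesis polyX : is_polytope (N%:Z - 1)%R X.
Hypothesis q_mono : {mono q : u v / u <= v}.
Hypothesis q_section : forall t, x <= t <= y <-> exists u, q u = t.
Hypothesis rk_section : rk y = (rk x + N)%N.

Let q_lt : {mono q : u v / u < v}.
Proof. by move=> u v; rewrite !lt_leAnge !q_mono. Qed.

Let q_inj : injective q.
Proof. by move=> u v e; apply/le_anti; rewrite -!q_mono e lexx. Qed.

(** The part from [x] to [y] of a flag through [q u] pulls back to [c 0 < ... < c N] in [X]. Ranks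
    there lie between 0 and [N] and strictly increase along [c], so [c k] has rank [k]. *)
Lemma chart_rank u : rk (q u) = (rk x + rk u)%N.
Proof.
have /andP[xu uy] : x <= q u <= y by apply/q_section; exists u.
have [f [sf fx fy]] := sflag_through polyT (le_trans xu uy).
have xy : (rk x <= rk y <= M)%N.
  by rewrite (rk_leM polyT) andbT; apply: (rk_le polyT (le_trans xu uy)).
have [||h [sh hu hf]] := sflag_insert polyT (x := q u) sf xy; rewrite ?fx ?fy//.
(* Beyond [N] the value [\bot] is only a placeholder. *)
have /choice[c cE] k : exists v, (k <= N)%N -> q v = h (rk x + k)%N.
  case: (leqP k N) => kN; last by exists \bot.
  have [v vE] : exists v, q v = h (rk x + k)%N.
    apply/q_section; rewrite -{1}fx -fy -!hf ?leqnn ?orbT//.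
    by rewrite !(sflag_homo sh)//; lia.
  by exists v.
have cS k : (k < N)%N -> (rk (c k) < rk (c k.+1))%N.
  move=> kN; apply: (rk_homo polyX); rewrite -q_lt !cE ?(ltnW kN)//.
  by apply: (sflag_lt sh); lia.
have low k : (k <= N)%N -> (k <= rk (c k))%N.
  by elim: k => // k IH kN; have := cS k kN; have := IH (ltnW kN); lia.
have high k : (k <= N)%N -> (rk (c (N - k)) <= N - k)%N.
  elim: k => [_|k IH kN]; first by rewrite subn0; apply: (rk_leM polyX).
  have := cS (N - k.+1)%N; have -> : ((N - k.+1).+1 = N - k)%N by lia.
  have := IH (ltnW kN); lia.
have rku : (rk x <= rk (q u) <= rk y)%N by rewrite !(rk_le polyT).
have uc : u = c (rk (q u) - rk x)%N.
  by apply: q_inj; rewrite cE ?subnKC ?hu//; lia.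
have := low (rk (q u) - rk x)%N; have := high (N - (rk (q u) - rk x))%N.
rewrite subKn; last by lia.
rewrite -uc; lia.
Qed.

Lemma chart_sflag f : sflag M f -> f (rk x) = x -> f (rk y) = y ->
  exists2 h, sflag N h & forall k, (k <= N)%N -> q (h k) = f (rk x + k)%N.
Proof.
move=> sf fx fy; have yM := rk_leM polyT y.
have /choice[h hE] k : exists v, q v = f (rk x + minn k N)%N.
  apply/q_section; rewrite -{1}fx -fy.
  by rewrite !(sflag_homo sf)//; lia.
exists h; last by move=> k kN; rewrite hE (minn_idPl kN).
split=> k; last by rewrite -q_mono !hE (sflag_homo sf)//; lia.
apply/eqP; rewrite -(eqn_add2l (rk x)) -chart_rank hE (proj1 sf); lia.
Qed.

End Charts.

Section RegularSections.
Context {d d' : Order.disp_t} {T : tbPOrderType d} {X : tbPOrderType d'}.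
Context {M N : nat}.
Hypothesis polyT : is_polytope (M%:Z - 1)%R T.
Hypothesis polyX : is_polytope (N%:Z - 1)%R X.

(** With charts [p] and [q] of the sections of [f] and [h], and an automorphism [g] of [X] matching
    the two flags pulled back to [X], the map inverting [p], then applying [g] and [q], is the local
    isomorphism required by [rigidP]. *)
Lemma regular_rigid a b : regular X -> (b = a + N)%N -> (b <= M)%N ->
  (forall f : nat -> T, sflag M f -> isomorphic (section (f a) (f b)) X) ->
  rigid (T := T) M a b.
Proof.
move=> regX bE bM isoX; apply: (rigidP polyT) => // f h sf sh.
have [p p_mono pE] := section_chart (isoX f sf).
have [q q_mono qE] := section_chart (isoX h sh).
have rkS (g : nat -> T) : sflag M g -> rk (g a) = a /\ rk (g b) = b.
  by move=> sg; rewrite !(proj1 sg); lia.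
have [rfa rfb] := rkS f sf; have [rha rhb] := rkS h sh.
have [|||f' sf' f'E] := chart_sflag polyT polyX p_mono pE _ sf.
- by rewrite rfa rfb.
- by rewrite rfa.
- by rewrite rfb.
have [|||h' sh' h'E] := chart_sflag polyT polyX q_mono qE _ sh.
- by rewrite rha rhb.
- by rewrite rha.
- by rewrite rhb.
rewrite rfa in f'E; rewrite rha in h'E.
have [g [_ g_mono g_rank] gfh] :=
  regX _ _ (sflag_range polyX sf') (sflag_range polyX sh').
(* Equality of the two ranges becomes equality at each index because [g] preserves ranks. *)
have gE k : g (f' k) = h' k.
  have : (g @` range f') (g (f' k)) by exists (f' k) => //; exists k.
  rewrite gfh => -[j _ jk]; rewrite -jk; apply: (rk_inj_comparable polyX).
    by apply: (proj1 (sflag_range polyX sh')); [exists j|exists k].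
  by rewrite jk (proj1 sh') -(proj1 sf') /rk g_rank.
pose r t := xget \bot [set u | p u = t].
have rK t : f a <= t <= f b -> p (r t) = t.
  by move=> /pE; apply: xgetPex.
have p_inj : injective p by move=> u v e; apply/le_anti; rewrite -!p_mono e lexx.
have pK u : r (p u) = u by apply/p_inj/rK/pE; exists u.
exists (fun t => q (g (r t))) => [u v uab vab|k kab].
  by rewrite q_mono g_mono -p_mono !rK.
rewrite -(subnKC (proj1 (andP kab))) -f'E; last by lia.
by rewrite pK gE h'E//; lia.
Qed.

End RegularSections.

Theorem theorem3p1 (n : int)
    (dP : Order.disp_t) (P : tbPOrderType dP)
    (dK : Order.disp_t) (K : finTBPOrderType dK)
    (dL : Order.disp_t) (L : finTBPOrderType dL) :
  is_polytope (n - 1)%R K -> flat K (n - 1)%R -> regular K ->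
  is_polytope (n - 1)%R L -> regular L ->
  is_polytope n P ->
  (forall F : P, facet n F -> isomorphic (section (\bot : P)%O F) K) ->
  (forall v : P, vertex v -> isomorphic (section v (\top : P)%O) L) ->
  ~ chiral P.
Proof.
move=> polyK flatK regK polyL regL polyP facetK vertexL.
have [M nE] := polytope_dim polyP; subst n.
apply: regular_not_chiral; apply: (flag_transitive polyP) => w f h wM sf sh.
have [M2|M3] := leqP M 2; first exact: (low_rank_stab polyP M2 wM sf sh).
(* Facets and vertex-figures are polytopes with [M.-1] in the place of [M]. *)
have nE : (M%:Z - 1 - 1 = (M.-1)%:Z - 1)%R by lia.
rewrite nE in polyK flatK polyL.
have isoK (F : P) : rk F = M.-1 -> isomorphic (section \bot F) K.
  by move=> rkF; apply: facetK; rewrite /facet (rank_rk polyP) rkF nE.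
have isoL (v : P) : rk v = 1%N -> isomorphic (section v \top) L.
  by move=> rkv; apply: vertexL; rewrite /vertex (rank_rk polyP) rkv.
apply: (flat_stab polyP M3 _ _ _ wM sf sh) => [||x y z rx ry rz xz yz].
- apply: (regular_rigid polyP polyK) => //; first by lia.
  by move=> g sg; rewrite (sflag0 polyP sg); apply: isoK; rewrite (proj1 sg); lia.
- apply: (regular_rigid polyP polyL) => //; first by lia.
  move=> g sg; rewrite (sflagM polyP sg (leqnn M)); apply: isoL.
  by rewrite (proj1 sg); lia.
(* In the chart of the facet [z], the faces [x] and [y] become a vertex and a facet of [K], to which
   flatness applies. *)
have [q q_mono qE] := section_chart (isoK z rz).
have rkq := chart_rank polyP polyK q_mono qE.
rewrite (rk_bot polyP) rz in rkq.
have [u ux] : exists u, q u = x by apply/qE; rewrite le0x.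
have [v vy] : exists v, q v = y by apply/qE; rewrite le0x.
have : v >=< u.
  apply: flatK; [rewrite /facet|rewrite /vertex]; rewrite (rank_rk polyK).
    by have := rkq erefl v; rewrite vy ry; lia.
  by have := rkq erefl u; rewrite ux rx; lia.
rewrite /Order.comparable -!q_mono ux vy => /orP[yx|//].
(* If [y] is below [x], then [M.-2 <= 1], so with [2 < M] both ranks are 1 and the two faces
   coincide. *)
have := rk_le polyP yx; rewrite rx ry => M12.
suff -> : x = y by [].
apply: (rk_inj_comparable polyP); last by lia.
by rewrite comparable_sym; apply: le_comparable.
Qed.
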